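(* Let $\mathcal X\subseteq\mathbb R^n$ and $\mathcal Y\subseteq\mathbb R^m$ be closed convex sets, $f:\mathcal X\to\mathbb R$ and $g:\mathcal Y\to\mathbb R$ convex functions, $A\in\mathbb R^{m\times n}$, $\alpha\in[0,1]$, and let $r,s>0$ satisfy $r\cdot s>(1-\alpha+\alpha^2)\rho(A^TA)$. Let $\{u^k\}$ be the sequence generated by the generalized CP-PPA with corresponding predictors $\tilde u^k$. For any integer $N>0$, define $$\bar u_N=\frac1{N+1}\sum_{k=0}^N\tilde u^k.$$ Then $\bar u_N\in\Omega$ and $$\theta(\bar u_N)-\theta(u)+(\bar u_N-u)^TF(u)\le\frac1{2(N+1)}\|u-u^0\|_H^2,\qquad\forall\,u\in\Omega.$$
   Context: $\rho(A^TA)$ is the largest eigenvalue of $A^TA$. Write $\mathcal L(x,y)=f(x)-y^TAx-g(y)$, $u=(x,y)\in\mathbb R^{n+m}$, $\Omega=\mathcal X\times\mathcal Y$, $\theta(u)=f(x)+g(y)$, and $F(u)=(-A^Ty,\;Ax)$. Matrices: $Q=\begin{pmatrix} rI_n & A^T\\ \alpha A & sI_m\end{pmatrix}$, $M=\begin{pmatrix} I_n & 0\\ -(1-\alpha)\frac1sA & I_m\end{pmatrix}$, $H=QM^{-1}$. For a matrix $S$, $\|v\|_S^2:=v^TSv$. The generalized CP-PPA, started from some $u^0=(x^0,y^0)\in\mathbb R^n\times\mathbb R^m$, generates for $k=0,1,2,\dots$ $$x^{k+1}=\arg\min\{\mathcal L(x,y^k)+\tfrac r2\|x-x^k\|^2:x\in\mathcal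 X\},\quad \bar x^{k+1}=x^{k+1}+\alpha(x^{k+1}-x^k),$$ $$\bar y^{k+1}=\arg\max\{\mathcal L(\bar x^{k+1},y)-\tfrac s2\|y-y^k\|^2:y\in\mathcal Y\},\quad y^{k+1}=\bar y^{k+1}-(1-\alpha)\tfrac1sA(x^{k+1}-x^k),$$ where the term $f(\bar x^{k+1})$, constant in $y$, is dropped in the third step. Its predictor is $\tilde u^k=(\tilde x^k,\tilde y^k)$ with $\tilde x^k=x^{k+1}$, $\tilde y^k=\bar y^{k+1}$; equivalently, $\tilde x^k=\arg\min\{\mathcal L(x,y^k)+\frac r2\|x-x^k\|^2:x\in\mathcal X\}$, $\tilde y^k=\arg\max\{\mathcal L(\tilde x^k+\alpha(\tilde x^k-x^k),y)-\frac s2\|y-y^k\|^2:y\in\mathcal Y\}$, and $u^{k+1}=u^k-M(u^k-\tilde u^k)$. *)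

(* Defs.v *)
From HB Require Import structures.
From mathcomp Require Import all_boot all_order all_algebra.
From mathcomp Require Import all_classical all_reals all_analysis.

Set Implicit Arguments.
Unset Strict Implicit.
Unset Printing Implicit Defensive.

Import Order.TTheory GRing.Theory Num.Theory.
Import numFieldNormedType.Exports.

Local Open Scope classical_set_scope.
Local Open Scope ring_scope.

Section Euclidean.
Context {R : realType}.

Definition dotv p (u v : 'cV[R]_p) : R := (u^T *m v) 0 0.

(* The library norm `|v| on matrices is the sup norm, hence the explicit
   squared Euclidean norm. *)
Definition sqnorm p (v : 'cV[R]_p) : R := dotv v v.

(* v^T S v, written ||v||_S^2 on paper even when S is not positive definite. *)
Definition sqnorm_wrt p (S : 'M[R]_p) (v : 'cV[R]_p) : R :=
  (v^T *m S *m v) 0 0.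

(* For S symmetric of positive size (the only use is S = A^T A) the set of
   eigenvalues is finite and nonempty, so that the supremum is the largest
   eigenvalue; for S of size 0 it is sup set0 = 0. *)
Definition max_eigenvalue p (S : 'M[R]_p) : R := sup [set a | eigenvalue S a].

Definition argmin (T : Type) (D : set T) (phi : T -> R) : set T :=
  [set x | D x /\ forall z, D z -> phi x <= phi z].

Definition argmax (T : Type) (D : set T) (phi : T -> R) : set T :=
  [set x | D x /\ forall z, D z -> phi z <= phi x].

End Euclidean.

Section SaddlePoint.
Context {R : realType} {n m : nat}.
Variables (X : set 'cV[R]_n) (Y : set 'cV[R]_m).
(* Functions on X and Y are represented by total functions; the values of f
   outside X and of g outside Y are never used. *)
Variables (f : 'cV[R]_n -> R) (g : 'cV[R]_m -> R).
Variable A : 'M[R]_(m, n).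

(* A point u = (x, y) of R^(n+m) is col_mx x y. *)
Definition Omega : set 'cV[R]_(n + m) :=
  [set u | X (usubmx u) /\ Y (dsubmx u)].

Definition theta (u : 'cV[R]_(n + m)) : R := f (usubmx u) + g (dsubmx u).

Definition saddle_op (u : 'cV[R]_(n + m)) : 'cV[R]_(n + m) :=
  col_mx (- (A^T *m dsubmx u)) (A *m usubmx u).

Definition lagrangian (x : 'cV[R]_n) (y : 'cV[R]_m) : R :=
  f x - dotv y (A *m x) - g y.

Variables (alpha r s : R).

Definition Qmx : 'M[R]_(n + m) :=
  block_mx r%:M A^T (alpha *: A) s%:M.

Definition Mmx : 'M[R]_(n + m) :=
  block_mx 1%:M 0 (- ((1 - alpha) * s^-1) *: A) 1%:M.

Definition Hmx : 'M[R]_(n + m) := Qmx *m invmx Mmx.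

(* The starting point (x 0, y 0) is arbitrary; xbar 0 and ybar 0 are
   irrelevant.  In cppa_ybar the Lagrangian is taken without the term
   f (xbar k.+1), constant in the maximisation variable: xbar k.+1 may lie
   outside the domain X of f. *)
Record generalized_cppa (x xbar : nat -> 'cV[R]_n) (y ybar : nat -> 'cV[R]_m) :
    Prop := GeneralizedCPPA {
  cppa_x : forall k,
    argmin X (fun z => lagrangian z (y k) + r / 2 * sqnorm (z - x k)) (x k.+1);
  cppa_xbar : forall k,
    xbar k.+1 = x k.+1 + alpha *: (x k.+1 - x k);
  cppa_ybar : forall k,
    argmax Y (fun z => - dotv z (A *m xbar k.+1) - g z
                       - s / 2 * sqnorm (z - y k)) (ybar k.+1);
  cppa_y : forall k,
    y k.+1 = ybar k.+1 - ((1 - alpha) * s^-1) *: (A *m (x k.+1 - x k)) }.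

End SaddlePoint.

Section Ergodic.
Context {R : realType} {n m : nat}.

Definition predictor (x : nat -> 'cV[R]_n) (ybar : nat -> 'cV[R]_m) (k : nat) :
  'cV[R]_(n + m) := col_mx (x k.+1) (ybar k.+1).

Definition ergodic_mean (x : nat -> 'cV[R]_n) (ybar : nat -> 'cV[R]_m)
    (N : nat) : 'cV[R]_(n + m) :=
  (N%:R + 1)^-1 *: \sum_(0 <= k < N.+1) predictor x ybar k.

End Ergodic.

(* Main.v *)
(** Convexity turns the optimality of both subproblems into the variational
    inequality
      theta u - theta u~^k + (u - u~^k)^T (F u~^k + Q (u~^k - u^k)) >= 0
    for u in Omega.  Since Q = H M and u^{k+1} = u^k - M (u^k - u~^k), the
    quadratic term equals
      1/2 (||u - u^k||_H^2 - ||u - u^{k+1}||_H^2 - ||u^k - u~^k||_G^2)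
    with G = Q + Q^T - M^T H M, while F is skew, so F u~^k may be replaced by
    F u.  Schur complements and A^T A <= rho(A^T A) I show that H and G are
    positive semidefinite; summing over k telescopes and Jensen's inequality
    passes to the ergodic mean. *)

Require Import Defs.
From HB Require Import structures.
From mathcomp Require Import all_boot all_order all_algebra.
From mathcomp Require Import all_classical all_reals all_analysis.
From mathcomp Require Import ring lra.

Set Implicit Arguments.
Unset Strict Implicit.
Unset Printing Implicit Defensive.

Import Order.TTheory GRing.Theory Num.Theory.
Import numFieldNormedType.Exports.

Local Open Scope classical_set_scope.
Local Open Scope ring_scope.

(** Stands in for the limit t -> 0+ in first-order optimality arguments. For a < 0, the chosen t
    makes a + t b a positive multiple of a. *)
Lemma ge0_of_small_perturbation (R : realFieldType) (a b : R) :
  (forall t, 0 < t -> t <= 1 -> 0 <= a + t * b) -> 0 <= a.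
Proof.
move=> ab; rewrite leNgt; apply/negP => a_lt0.
have d_gt0 : 0 < `|b| + 1 - a by have := normr_ge0 b; lra.
have t_gt0 : 0 < - a / (`|b| + 1 - a) by rewrite divr_gt0 ?oppr_gt0.
have t_le1 : - a / (`|b| + 1 - a) <= 1.
  by rewrite ler_pdivrMr//; have := normr_ge0 b; lra.
have := ab _ t_gt0 t_le1; apply/negP; rewrite -ltNge.
rewrite mulrAC -[X in X + _](mulfK (lt0r_neq0 d_gt0)) -mulrDl pmulr_llt0 ?invr_gt0//.
have /ler_normlP[_ b_le] := lexx `|b|.
by rewrite (_ : _ + _ = a * (`|b| - b + 1 - a)); [rewrite nmulr_rlt0//; lra | ring].
Qed.

(** * Euclidean inner product *)

Section DotProduct.
Context {R : realType}.

Lemma dotvE p (u v : 'cV[R]_p) : dotv u v = \sum_i u i 0 * v i 0.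
Proof. by rewrite /dotv mxE; apply: eq_bigr => i _; rewrite mxE. Qed.

Lemma dotvC p (u v : 'cV[R]_p) : dotv u v = dotv v u.
Proof. by rewrite !dotvE; apply: eq_bigr => i _; rewrite mulrC. Qed.

Lemma dotvDl p (u v w : 'cV[R]_p) : dotv (u + v) w = dotv u w + dotv v w.
Proof. by rewrite /dotv linearD mulmxDl mxE. Qed.

Lemma dotvDr p (u v w : 'cV[R]_p) : dotv w (u + v) = dotv w u + dotv w v.
Proof. by rewrite /dotv mulmxDr mxE. Qed.

Lemma dotvNl p (u w : 'cV[R]_p) : dotv (- u) w = - dotv u w.
Proof. by rewrite /dotv linearN mulNmx mxE. Qed.

Lemma dotvNr p (u w : 'cV[R]_p) : dotv w (- u) = - dotv w u.
Proof. by rewrite /dotv mulmxN mxE. Qed.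

Lemma dotvZl p a (u w : 'cV[R]_p) : dotv (a *: u) w = a * dotv u w.
Proof. by rewrite /dotv linearZ -scalemxAl mxE. Qed.

Lemma dotvZr p a (u w : 'cV[R]_p) : dotv w (a *: u) = a * dotv w u.
Proof. by rewrite /dotv -scalemxAr mxE. Qed.

Definition dotv_bilin := (dotvDl, dotvDr, dotvNl, dotvNr, dotvZl, dotvZr).

Lemma dotv_mulmx p q (S : 'M[R]_(p, q)) (u : 'cV[R]_p) (v : 'cV[R]_q) :
  dotv u (S *m v) = dotv (S^T *m u) v.
Proof. by rewrite /dotv trmx_mul trmxK mulmxA. Qed.

Lemma dotv_suml p (I : Type) (l : seq I) (u : I -> 'cV[R]_p) (w : 'cV[R]_p) :
  dotv (\sum_(i <- l) u i) w = \sum_(i <- l) dotv (u i) w.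
Proof. by rewrite /dotv raddf_sum mulmx_suml summxE. Qed.

Lemma dotv_col_mx p q (u u' : 'cV[R]_p) (v v' : 'cV[R]_q) :
  dotv (col_mx u v) (col_mx u' v') = dotv u u' + dotv v v'.
Proof. by rewrite /dotv tr_col_mx mul_row_col mxE. Qed.

Lemma sqnorm_ge0 p (u : 'cV[R]_p) : 0 <= sqnorm u.
Proof. by rewrite /sqnorm dotvE sumr_ge0// => i _; rewrite -expr2 sqr_ge0. Qed.

Lemma coord_sqr_le_sqnorm p (u : 'cV[R]_p) i : u i 0 ^+ 2 <= sqnorm u.
Proof.
rewrite /sqnorm dotvE (bigD1 i)//= -expr2 lerDl sumr_ge0// => j _.
by rewrite -expr2 sqr_ge0.
Qed.

Lemma sqnorm_eq0 p (u : 'cV[R]_p) : (sqnorm u == 0) = (u == 0).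
Proof.
apply/eqP/eqP => [u0|->]; last by rewrite /sqnorm /dotv mulmx0 mxE.
apply/matrixP => i j; rewrite ord1 mxE; apply/eqP.
by rewrite -sqrf_eq0 eq_le sqr_ge0 -u0 coord_sqr_le_sqnorm.
Qed.

End DotProduct.

(** * Rayleigh quotients and the largest eigenvalue *)

Section Rayleigh.
Context {R : realType} {n : nat}.

Let sphere : set 'rV[R]_n := [set w | sqnorm w^T = 1].

Let bilin_continuous (S : 'M[R]_n) :
  continuous (fun w : 'rV[R]_n => dotv w^T (S *m w^T)).
Proof.
have -> : (fun w : 'rV[R]_n => dotv w^T (S *m w^T)) =
    (fun w => \sum_i (w 0 i * \sum_j (S i j * w 0 j))).
  apply/funext => z; rewrite dotvE; apply: eq_bigr => i _.
  by rewrite !mxE; congr (_ * _); apply: eq_bigr => j _; rewrite mxE.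
apply: continuous_big => [|i _ w]; first exact: add_continuous.
apply: continuousM; first exact: coord_continuous.
move: w; apply: continuous_big => [|j _ w]; first exact: add_continuous.
by apply: continuousM; [exact: cst_continuous | exact: coord_continuous].
Qed.

(** The sphere is closed and lies in the compact box [-1, 1]^n, since each squared coordinate is at
    most the squared norm. *)
Let sphere_compact : compact sphere.
Proof.
have box_compact : compact
    [set v : 'rV[R]_n | forall i, [set t : R | t \in `[-1, 1]] (v ord0 i)].
  by apply: (@rV_compact R n (fun=> [set t : R | t \in `[-1, 1]])) => _; exact: segment_compact.
apply: subclosed_compact box_compact _.
- apply: (@preimage_closed _ _ (fun w : 'rV[R]_n => sqnorm w^T) [set t | t = 1]).
    move=> w _; have := @bilin_continuous 1%:M w.
    by under eq_fun do rewrite mul1mx.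
  exact: closed_eq.
- move=> w w1 i /=; rewrite in_itv/= -ler_norml.
  by rewrite -(@ler_pXn2r _ 2)// ?nnegrE// expr1n real_normK ?num_real// -w1
    (le_trans _ (coord_sqr_le_sqnorm _ i))// mxE.
Qed.

(* A maximiser of v^T S v on the unit sphere is an eigenvector: first-order
   perturbation around it kills S e - l e. *)
Lemma dotv_mulmx_le_max_eigenvalue (S : 'M[R]_n) (v : 'cV[R]_n) :
  S^T = S -> dotv v (S *m v) <= max_eigenvalue S * sqnorm v.
Proof.
(* The case v = 0 also settles n = 0, where the unit sphere is empty. *)
move=> symS; have [->|v_neq0] := eqVneq v 0.
  by rewrite /sqnorm mulmx0 /dotv mulmx0 !mxE mulr0.
have normalize (u : 'cV[R]_n) : u != 0 -> sphere ((Num.sqrt (sqnorm u))^-1 *: u)^T.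
  move=> u_neq0; rewrite /sphere/= trmxK /sqnorm !dotv_bilin mulrA -invfM -expr2.
  by rewrite sqr_sqrtr ?sqnorm_ge0// mulVf// sqnorm_eq0.
have [] := @EVT_max_rV R n (fun w : 'rV[R]_n => dotv w^T (S *m w^T)) sphere.
- by exists ((Num.sqrt (sqnorm v))^-1 *: v)^T; exact: normalize.
- exact: sphere_compact.
- exact/continuous_subspaceT/bilin_continuous.
move=> w; rewrite inE /sphere/= => w1 w_max.
pose e := w^T; pose l := dotv e (S *m e).
have form_le (u : 'cV[R]_n) : dotv u (S *m u) <= l * sqnorm u.
  have [->|u_neq0] := eqVneq u 0.
    by rewrite /sqnorm mulmx0 /dotv mulmx0 !mxE mulr0.
  have /= := w_max _ (mem_set (normalize _ u_neq0)).
  rewrite trmxK -scalemxAr !dotv_bilin mulrA -invfM -expr2 sqr_sqrtr ?sqnorm_ge0//.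
  by rewrite mulrC ler_pdivrMr// lt_def sqnorm_ge0 sqnorm_eq0 u_neq0.
have eigen_e : S *m e = l *: e.
  apply/eqP; rewrite -subr_eq0 -sqnorm_eq0 eq_le sqnorm_ge0 andbT -oppr_ge0.
  move zE : (S *m e - l *: e) => z.
  (* [form_le] at e + t z reduces to 2 |z|^2 <= t (l |z|^2 - z^T S z); letting t -> 0 forces z =
     0. *)
  apply: (@ge0_of_small_perturbation _ _ ((l * sqnorm z - dotv z (S *m z)) / 2)) => t t_gt0 _.
  have := form_le (e + t *: z).
  rewrite mulmxDr -scalemxAr /sqnorm !dotv_bilin.
  rewrite (dotvC z e) [dotv e (S *m z)]dotv_mulmx symS (dotvC _ z) -/l (_ : dotv e e = 1)//.
  have -> : dotv z (S *m e) = sqnorm z + l * dotv e z.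
    rewrite /sqnorm -{3}zE !dotv_bilin (dotvC e z); ring.
  rewrite -/(sqnorm z) => form_t; rewrite -(pmulr_rge0 _ t_gt0); lra.
apply: le_trans (form_le v) _; apply: ler_wpM2r; first exact: sqnorm_ge0.
(* A supremum dominates l only if the spectrum is bounded above and contains l. By [form_le], l
   itself is a bound; symmetry of S passes between column vectors and the row eigenvectors of
   [eigenvalue]. *)
apply: ub_le_sup.
  exists l => a /eigenvalueP[u uS u_neq0].
  have uT_gt0 : 0 < sqnorm u^T.
    by rewrite lt_def sqnorm_ge0 sqnorm_eq0 -trmx0 (inj_eq trmx_inj) u_neq0.
  rewrite -(ler_pM2r uT_gt0) -[leLHS]dotvZr.
  suff <- : S *m u^T = a *: u^T by exact: form_le.
  by rewrite -symS -trmx_mul uS linearZ.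
apply/eigenvalueP; exists w.
  by apply: trmx_inj; rewrite trmx_mul symS linearZ.
by apply: contra_eq_neq w1 => ->; rewrite trmx0 /sqnorm /dotv mulmx0 mxE eq_sym oner_eq0.
Qed.

End Rayleigh.

(** * Convex combinations, Jensen's inequality and proximal optimality *)

Section Convexity.
Context {R : realType} {p : nat}.
Variable D : set 'cV[R]_p.
Hypothesis convexD : convex_set D.

Lemma convex_set_comb (t : R) (u v : 'cV[R]_p) :
  0 <= t -> t <= 1 -> D u -> D v -> D (t *: u + (1 - t) *: v).
Proof.
move=> t_ge0 t_le1 Du Dv; apply: set_mem.
exact: (@convexD u v (Itv01 t_ge0 t_le1) (mem_set Du) (mem_set Dv)).
Qed.

Lemma convex_function_comb (phi : 'cV[R]_p -> R) (t : R) (u v : 'cV[R]_p) :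
  convex_function D phi -> 0 <= t -> t <= 1 -> D u -> D v ->
  phi (t *: u + (1 - t) *: v) <= t * phi u + (1 - t) * phi v.
Proof.
move=> convex_phi t_ge0 t_le1 Du Dv.
exact: (convex_phi (Itv01 t_ge0 t_le1) u v (mem_set Du) (mem_set Dv)).
Qed.

(** Reduces Jensen's inequality to two-point convexity; a general module V covers both the points
    and the values of the function. *)
Lemma mean_recr (V : lmodType R) (v : nat -> V) N :
  let t := (N.+1%:R + 1 : R)^-1 in
  t *: \sum_(0 <= k < N.+2) v k =
  t *: v N.+1 + (1 - t) *: ((N%:R + 1)^-1 *: \sum_(0 <= k < N.+1) v k).
Proof.
move=> t; rewrite big_nat_recr//= scalerDr addrC; congr (_ + _).
rewrite scalerA; congr (_ *: _); rewrite /t -natr1.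
have : 0 <= N%:R :> R by exact: ler0n.
by move=> N_ge0; field; apply/andP; split; apply: lt0r_neq0; lra.
Qed.

(** Both claims share one induction: two-point convexity needs the previous mean to lie in D. *)
Lemma jensen_mean (phi : 'cV[R]_p -> R) (v : nat -> 'cV[R]_p) N :
  convex_function D phi -> (forall k, D (v k)) ->
  D ((N%:R + 1)^-1 *: \sum_(0 <= k < N.+1) v k) /\
  phi ((N%:R + 1)^-1 *: \sum_(0 <= k < N.+1) v k) <=
    (N%:R + 1)^-1 * \sum_(0 <= k < N.+1) phi (v k).
Proof.
move=> convex_phi Dv; elim: N => [|N [Dmean phi_mean]].
  by rewrite add0r invr1 scale1r mul1r !big_nat1.
have t_ge0 : 0 <= (N.+1%:R + 1 : R)^-1 by rewrite invr_ge0 addr_ge0.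
have t_le1 : (N.+1%:R + 1 : R)^-1 <= 1 by rewrite invf_le1 ?ltr_wpDl// lerDr.
rewrite !mean_recr; split; first exact: convex_set_comb.
apply: le_trans (convex_function_comb convex_phi _ _ (Dv _) Dmean) _ => //.
have /= := @mean_recr R^o (phi \o v) N; rewrite /GRing.scale/= => ->.
by rewrite lerD2l ler_wpM2l// subr_ge0.
Qed.

(** Compare x1 with x1 + t (z - x1), divide by t and let t -> 0: the remainder t w/2 |z - x1|^2
    vanishes. *)
Lemma argmin_prox_variational (phi : 'cV[R]_p -> R) (w : R) (q x0 x1 : 'cV[R]_p) :
  convex_function D phi ->
  argmin D (fun z => phi z + dotv z q + w / 2 * sqnorm (z - x0)) x1 ->
  forall z, D z ->
    0 <= phi z - phi x1 + dotv (z - x1) (q + w *: (x1 - x0)).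
Proof.
move=> convex_phi [Dx1 x1_min] z Dz.
apply: (@ge0_of_small_perturbation _ _ (w / 2 * sqnorm (z - x1))) => t t_gt0 t_le1.
have := x1_min _ (convex_set_comb (ltW t_gt0) t_le1 Dz Dx1).
have := convex_function_comb convex_phi (ltW t_gt0) t_le1 Dz Dx1.
have -> : t *: z + (1 - t) *: x1 = x1 + t *: (z - x1).
  by rewrite scalerBl scale1r scalerBr addrCA.
rewrite (addrAC x1 _ (- x0)); move: (z - x1) (x1 - x0) => d e phi_zt.
rewrite /sqnorm !dotv_bilin (dotvC e d) => min_zt.
rewrite -(pmulr_rge0 _ t_gt0); lra.
Qed.

End Convexity.

(** * The quadratic forms of H and G *)

Section OneStep.
Context {R : realType} {n m : nat}.
Variables (A : 'M[R]_(m, n)) (alpha r s : R).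

(* ||(a, b)||_S^2 for S = [[r I + c A^T A, A^T], [A, s I]]; H is the case
   c = (1 - alpha) / s, and G the case c = alpha (1 - alpha) / s. *)
Definition coupled_form (c : R) (a : 'cV[R]_n) (b : 'cV[R]_m) : R :=
  r * sqnorm a + c * sqnorm (A *m a) + 2 * dotv b (A *m a) + s * sqnorm b.

(** Completing the square in b, which is the Schur complement criterion. H is the case kappa =
    alpha, G the case kappa = 1 - alpha + alpha^2. *)
Lemma coupled_form_ge0 (kappa : R) a b :
  0 < s -> kappa * sqnorm (A *m a) <= r * s * sqnorm a ->
  0 <= coupled_form ((1 - kappa) / s) a b.
Proof.
move=> s_gt0 kappa_le; rewrite -(pmulr_rge0 _ s_gt0).
have -> : s * coupled_form ((1 - kappa) / s) a b =
    (r * s * sqnorm a - kappa * sqnorm (A *m a)) + sqnorm (A *m a + s *: b).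
  rewrite /coupled_form /sqnorm !dotv_bilin (dotvC (A *m a) b).
  by field; exact: lt0r_neq0.
by rewrite addr_ge0 ?sqnorm_ge0// subr_ge0.
Qed.

(** Inverting the unit triangular M flips the sign of its lower block; the lower left block of H is
    then alpha A + (1 - alpha) A = A, so H is symmetric. *)
Lemma HmxE : s != 0 ->
  Hmx A alpha r s =
  block_mx (r%:M + ((1 - alpha) / s) *: (A^T *m A)) A^T A s%:M.
Proof.
rewrite /Hmx => s_neq0; have -> : invmx (Mmx A alpha s) = block_mx 1%:M 0 (((1 - alpha) / s) *: A) 1%:M.
  have NM : block_mx 1%:M 0 (((1 - alpha) / s) *: A) 1%:M *m Mmx A alpha s = 1%:M.
    rewrite mulmx_block !mul1mx !mulmx1 !mul0mx !mulmx0 !addr0 add0r.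
    by rewrite scaleNr subrr -scalar_mx_block.
  by rewrite -[LHS]mul1mx -NM -mulmxA mulmxV ?mulmx1//; case: (mulmx1_unit NM).
rewrite /Qmx mulmx_block !mulmx1 !mulmx0 !add0r -scalemxAr mul_scalar_mx scalerA.
rewrite -scalerDl.
by rewrite (_ : alpha + _ = 1) ?scale1r//; field.
Qed.

Lemma sqnorm_wrt_HmxE (v : 'cV[R]_(n + m)) : s != 0 ->
  sqnorm_wrt (Hmx A alpha r s) v =
  coupled_form ((1 - alpha) / s) (usubmx v) (dsubmx v).
Proof.
move=> s_neq0; rewrite -[v in LHS]vsubmxK; move: (usubmx v) (dsubmx v) => a b.
rewrite /sqnorm_wrt -mulmxA -/(dotv _ _) HmxE// mul_block_col dotv_col_mx.
rewrite mulmxDl !mul_scalar_mx -scalemxAl -mulmxA !dotv_bilin.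
rewrite !(dotv_mulmx A^T) trmxK (dotvC (A *m a) b) /coupled_form /sqnorm; ring.
Qed.

End OneStep.

(** * Variational inequalities and the one-step estimate *)

Section Iteration.
Context {R : realType} {n m : nat}.
Variables (X : set 'cV[R]_n) (Y : set 'cV[R]_m).
Variables (f : 'cV[R]_n -> R) (g : 'cV[R]_m -> R).
Variables (A : 'M[R]_(m, n)) (alpha r s : R).
Variables (x xbar : nat -> 'cV[R]_n) (y ybar : nat -> 'cV[R]_m).
Hypotheses (convexX : convex_set X) (convexY : convex_set Y).
Hypotheses (convexf : convex_function X f) (convexg : convex_function Y g).
Hypothesis cppa : generalized_cppa X Y f g A alpha r s x xbar y ybar.

(** Here the linear term has q = - A^T y^k, and g(y^k) is constant in the minimisation variable. *)
Lemma cppa_x_variational k p : X p ->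
  0 <= f p - f (x k.+1) + dotv (p - x k.+1) (- (A^T *m y k) + r *: (x k.+1 - x k)).
Proof.
move=> Xp; apply: (argmin_prox_variational convexX convexf) => //.
have [Xx x_min] := cppa_x cppa k; split=> // z /x_min.
rewrite /lagrangian !dotvNr !(dotv_mulmx A^T) trmxK.
rewrite (dotvC (y k) (A *m x k.+1)) (dotvC (y k) (A *m z)); lra.
Qed.

Lemma cppa_y_variational k q : Y q ->
  0 <= g q - g (ybar k.+1)
       + dotv (q - ybar k.+1) (A *m xbar k.+1 + s *: (ybar k.+1 - y k)).
Proof.
move=> Yq; apply: (argmin_prox_variational convexY convexg) => //.
by have [Yy y_max] := cppa_ybar cppa k; split=> // z /y_max; lra.
Qed.

(** The right side minus the left is the sum of the two variational expressions and half the G-form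
    at u~^k - u^k, all nonnegative. *)
Lemma cppa_step k (u : 'cV[R]_(n + m)) : 0 < s ->
  (forall a, (1 - alpha + alpha ^+ 2) * sqnorm (A *m a) <= r * s * sqnorm a) ->
  Omega X Y u ->
  theta f g (predictor x ybar k) - theta f g u
    + dotv (predictor x ybar k - u) (saddle_op A u)
  <= 2^-1 * (sqnorm_wrt (Hmx A alpha r s) (u - col_mx (x k) (y k))
             - sqnorm_wrt (Hmx A alpha r s) (u - col_mx (x k.+1) (y k.+1))).
Proof.
move=> s_gt0 rs_ge; rewrite /Omega/= -[u]vsubmxK.
move: (usubmx u) (dsubmx u) => p q; rewrite col_mxKu col_mxKd => -[Xp Yq].
have := cppa_y_variational k Yq; have := cppa_x_variational k Xp.
have := coupled_form_ge0 (ybar k.+1 - y k) s_gt0 (rs_ge (x k.+1 - x k)).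
rewrite !sqnorm_wrt_HmxE ?lt0r_neq0// /theta /predictor /saddle_op.
rewrite !opp_col_mx !add_col_mx !col_mxKu !col_mxKd dotv_col_mx.
rewrite (cppa_y cppa) (cppa_xbar cppa).
(* Taking beta = (1 - alpha) / s as parameter removes every division, leaving a polynomial
   identity. *)
have [beta alphaE] : exists beta, alpha = 1 - s * beta.
  by exists ((1 - alpha) / s); field; exact: lt0r_neq0.
have -> : (1 - alpha) / s = beta by rewrite alphaE; field; exact: lt0r_neq0.
have -> : (1 - (1 - alpha + alpha ^+ 2)) / s = alpha * beta.
  by rewrite alphaE; field; exact: lt0r_neq0.
move: (x k) (x k.+1) (y k) (ybar k.+1) => x0 x1 y0 y1.
(* All vectors are rewritten through u - u~^k and u~^k - u^k, so that both sides expand into the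
   same inner products. *)
have -> : p - x0 = (p - x1) + (x1 - x0) by rewrite addrA subrK.
have -> : q - y0 = (q - y1) + (y1 - y0) by rewrite addrA subrK.
have -> : q - (y1 - beta *: (A *m (x1 - x0))) = (q - y1) + beta *: (A *m (x1 - x0)).
  by rewrite opprB addrCA addrC.
rewrite -(opprB p x1) -(opprB q y1).
have -> : A *m p = A *m x1 + A *m (p - x1) by rewrite -mulmxDr addrC subrK.
have -> : A^T *m q = A^T *m y1 + A^T *m (q - y1) by rewrite -mulmxDr addrC subrK.
have -> : A^T *m y0 = A^T *m y1 - A^T *m (y1 - y0) by rewrite -mulmxBr opprB addrC subrK.
move: (p - x1) (q - y1) (x1 - x0) (y1 - y0) => c d a b.
rewrite /coupled_form /sqnorm !mulmxDr -!scalemxAr !dotv_bilin !(dotv_mulmx A^T) trmxK.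
rewrite (dotvC a c) (dotvC (A *m a) (A *m c)) (dotvC b d).
rewrite (dotvC (A *m a) d) (dotvC (A *m c) d) (dotvC (A *m c) b) (dotvC (A *m c) y1).
rewrite alphaE; lra.
Qed.

End Iteration.

(** * Summation and passage to the ergodic mean *)

Theorem theorem5p2 (R : realType) (n m : nat)
    (X : set 'cV[R]_n) (Y : set 'cV[R]_m)
    (f : 'cV[R]_n -> R) (g : 'cV[R]_m -> R)
    (A : 'M[R]_(m, n)) (alpha r s : R)
    (x xbar : nat -> 'cV[R]_n) (y ybar : nat -> 'cV[R]_m)
    (closedX : closed X) (convexX : convex_set X)
    (closedY : closed Y) (convexY : convex_set Y)
    (convexf : convex_function X f) (convexg : convex_function Y g)
    (alpha_ge0 : 0 <= alpha) (alpha_le1 : alpha <= 1)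
    (r_gt0 : 0 < r) (s_gt0 : 0 < s)
    (rs_gt : (1 - alpha + alpha ^+ 2) * max_eigenvalue (A^T *m A) < r * s)
    (cppa : generalized_cppa X Y f g A alpha r s x xbar y ybar)
    (N : nat) (N_gt0 : (0 < N)%N) :
  Omega X Y (ergodic_mean x ybar N) /\
  forall u : 'cV[R]_(n + m), Omega X Y u ->
    theta f g (ergodic_mean x ybar N) - theta f g u
      + dotv (ergodic_mean x ybar N - u) (saddle_op A u)
    <= (2 * (N%:R + 1))^-1
         * sqnorm_wrt (Hmx A alpha r s) (u - col_mx (x 0%N) (y 0%N)).
Proof.
have rs_ge a : (1 - alpha + alpha ^+ 2) * sqnorm (A *m a) <= r * s * sqnorm a.
  have -> : sqnorm (A *m a) = dotv a ((A^T *m A) *m a).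
    by rewrite -mulmxA dotv_mulmx trmxK.
  have kappa_ge0 : 0 <= 1 - alpha + alpha ^+ 2 by rewrite addr_ge0 ?sqr_ge0// subr_ge0.
  apply: le_trans (ler_wpM2r (sqnorm_ge0 a) (ltW rs_gt)); rewrite -mulrA.
  apply: ler_wpM2l => //; apply: dotv_mulmx_le_max_eigenvalue.
  by rewrite trmx_mul trmxK.
(* The bound obtained for G suffices for H, because 1 - alpha + alpha^2 exceeds alpha by (1 -
   alpha)^2. *)
have H_ge0 v : 0 <= sqnorm_wrt (Hmx A alpha r s) v.
  rewrite sqnorm_wrt_HmxE ?lt0r_neq0//; apply: coupled_form_ge0 => //.
  apply: le_trans (rs_ge _); apply: ler_wpM2r; first exact: sqnorm_ge0.
  by rewrite -subr_ge0 (_ : _ - _ = (1 - alpha) ^+ 2) ?sqr_ge0//; ring.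
have mean_u : usubmx (ergodic_mean x ybar N) =
    (N%:R + 1)^-1 *: \sum_(0 <= k < N.+1) x k.+1.
  rewrite /ergodic_mean linearZ raddf_sum/=; congr (_ *: _).
  by apply: eq_bigr => k _; rewrite col_mxKu.
have mean_d : dsubmx (ergodic_mean x ybar N) =
    (N%:R + 1)^-1 *: \sum_(0 <= k < N.+1) ybar k.+1.
  rewrite /ergodic_mean linearZ raddf_sum/=; congr (_ *: _).
  by apply: eq_bigr => k _; rewrite col_mxKd.
have [Xmean f_mean] := jensen_mean convexX N convexf (fun k => (cppa_x cppa k).1).
have [Ymean g_mean] := jensen_mean convexY N convexg (fun k => (cppa_ybar cppa k).1).
split=> [|u Omega_u]; first by rewrite /Omega/= mean_u mean_d.
set h := sqnorm_wrt _.
have N1_gt0 : 0 < N%:R + 1 :> R by rewrite ltr_wpDl.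
have steps : \sum_(0 <= k < N.+1) (theta f g (predictor x ybar k) - theta f g u
      + dotv (predictor x ybar k - u) (saddle_op A u))
    <= 2^-1 * h (u - col_mx (x 0%N) (y 0%N)).
  apply: le_trans (ler_sum _ (fun k _ => cppa_step convexX convexY convexf
    convexg cppa k s_gt0 rs_ge Omega_u)) _.
  rewrite -mulr_sumr ler_wpM2l ?invr_ge0//.
  (* Only h(u - u^0) - h(u - u^(N+1)) survives, and [H_ge0] discards the last term. *)
  have := telescope_sumr (fun k => - h (u - col_mx (x k) (y k))) (leq0n N.+1).
  under eq_bigr do rewrite opprK addrC.
  by move=> ->; rewrite opprK addrC lerBlDr lerDl.
apply: (@le_trans _ _ ((N%:R + 1)^-1 * \sum_(0 <= k < N.+1)
    (theta f g (predictor x ybar k) - theta f g u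
      + dotv (predictor x ybar k - u) (saddle_op A u)))); last first.
  by rewrite invfM [2^-1 * _]mulrC -mulrA ler_wpM2l// invr_ge0 ltW.
set F := saddle_op A u.
(* As F is fixed at u, the inner product averages exactly; Jensen's inequality is used only for f
   and g. *)
rewrite (eq_bigr (fun k => f (x k.+1) + g (ybar k.+1) + dotv (predictor x ybar k) F
    - (theta f g u + dotv u F))); last first.
  by move=> k _; rewrite dotvDl dotvNl {1}/theta /predictor col_mxKu col_mxKd; ring.
rewrite sumrB sumr_const_nat !big_split/= -dotv_suml subn0 -[_ *+ N.+1]mulr_natr -natr1.
rewrite mulrBr mulrCA mulVf ?lt0r_neq0// mulr1 !mulrDr -[_ * dotv _ F]dotvZl.
rewrite -/(ergodic_mean x ybar N) dotvDl dotvNl {1}/theta mean_u mean_d; lra.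
Qed.
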